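(* Let $A$ be a set with two binary operations $\diamond$ and $\circ$ such that $(A,\diamond)$ is a group and $(A,\circ)$ is a semigroup. Then the following statements are equivalent: (1) There exists $\sigma: A\to A$ such that $(A,\diamond,\circ,\sigma)$ is a skew truss. (2) There exists a map $\lambda: A\to \mathrm{Map}(A,A)$, $a\mapsto \lambda_a$, such that for all $a,b,c\in A$, $a\circ(b\diamond c) = (a\circ b)\diamond \lambda_a(c)$. (3) There exists a map $\mu: A\to \mathrm{Map}(A,A)$, $a\mapsto \mu_a$, such that for all $a,b,c\in A$, $a\circ(b\diamond c) = \mu_a(b)\diamond(a\circ c)$. (4) There exist maps $\kappa,\hat\kappa: A\to \mathrm{Map}(A,A)$, $a\mapsto\kappa_a$, $a\mapsto\hat\kappa_a$, such that for all $a,b,c\in A$, $a\circ(b\diamond c) = \kappa_a(b)\diamond\hat\kappa_a(c)$. (5) With the ternary operation $[-,-,-]:A\times A\times A\to A$ defined by $[a,b,c] := a\diamond b^\diamond\diamond c$, one has, for all $a,b,c,d\in A$, $a\circ[b,c,d] = [a\circ b, a\circ c, a\circ d]$.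
   Context: For a group $(A,\diamond)$, $a^\diamond$ denotes the inverse of $a$ with respect to $\diamond$. $\mathrm{Map}(A,A)$ is the set of all functions $A\to A$. A skew (left) truss is a quadruple $(A,\diamond,\circ,\sigma)$ where $(A,\diamond)$ is a group, $(A,\circ)$ is a semigroup (i.e. $\circ$ is associative) and $\sigma:A\to A$ is a function such that for all $a,b,c\in A$, $a\circ(b\diamond c) = (a\circ b)\diamond\sigma(a)^\diamond\diamond(a\circ c)$. *)

(* Defs.v *)
From mathcomp Require Import all_boot.

Set Implicit Arguments.
Unset Strict Implicit.
Unset Printing Implicit Defensive.

(* MathComp's groupType and semigroupType would impose a choiceType structure
   (hence decidable equality) on the carrier, and would not let two operations
   live on one type; these unbundled predicates apply to any type. *)
Record is_group (A : Type) (dia : A -> A -> A) (e : A) (inv : A -> A) : Prop :=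
  IsGroup {
    group_assoc : associative dia;
    group_left_id : left_id e dia;
    group_right_id : right_id e dia;
    group_left_inv : left_inverse e inv dia;
    group_right_inv : right_inverse e inv dia
  }.

Definition is_semigroup (A : Type) (circ : A -> A -> A) : Prop :=
  associative circ.

Record is_skew_truss (A : Type) (dia : A -> A -> A) (e : A) (inv : A -> A)
    (circ : A -> A -> A) (sigma : A -> A) : Prop :=
  IsSkewTruss {
    truss_group : is_group dia e inv;
    truss_semigroup : is_semigroup circ;
    truss_distr : forall a b c : A,
      circ a (dia b c) = dia (dia (circ a b) (inv (sigma a))) (circ a c)
  }.

Definition heap (A : Type) (dia : A -> A -> A) (inv : A -> A) (a b c : A) : A :=
  dia (dia a (inv b)) c.

(* Main.v *)
(* An operation with a o (b * c) = kappa_a(b) * kappahat_a(c) satisfies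
   a o b = kappa_a(b * c^-1) * kappahat_a(c), a o c = kappa_a(1) * kappahat_a(c)
   and a o d = kappa_a(1) * kappahat_a(d); in
   (a o b) * (a o c)^-1 * (a o d) the factors kappahat_a(c) and kappa_a(1)
   cancel, leaving kappa_a(b * c^-1) * kappahat_a(d) = a o [b, c, d].
   Conversely, taking the middle argument of the heap to be the identity gives
   a skew truss with sigma(a) = a o 1. *)

Require Import Defs.
From mathcomp Require Import all_boot.

Section Group.

Set Implicit Arguments.
Unset Strict Implicit.

Variables (A : Type) (dia : A -> A -> A) (e : A) (inv : A -> A).
Hypothesis gA : is_group dia e inv.

Lemma group_mulKV x y : dia x (dia (inv x) y) = y.
Proof.
by rewrite (group_assoc gA) (group_right_inv gA) (group_left_id gA).
Qed.

Lemma group_mulVK x y : dia (inv x) (dia x y) = y.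
Proof.
by rewrite (group_assoc gA) (group_left_inv gA) (group_left_id gA).
Qed.

Lemma group_invM x y : inv (dia x y) = dia (inv y) (inv x).
Proof.
rewrite -[RHS](group_mulVK (dia x y)) -(group_assoc gA) group_mulKV.
by rewrite (group_right_inv gA) (group_right_id gA).
Qed.

Lemma group_inv1 : inv e = e.
Proof. by rewrite -[LHS](group_left_id gA) (group_right_inv gA). Qed.

Lemma heap1 x y : heap dia inv x e y = dia x y.
Proof. by rewrite /heap group_inv1 (group_right_id gA). Qed.

(** Inversion reverses [dia z y], so [y] meets its inverse first and then [z] meets its own. *)
Lemma heap_mul x y z t :
  heap dia inv (dia x y) (dia z y) (dia z t) = dia x t.
Proof.
by rewrite /heap group_invM -!(group_assoc gA) group_mulVK group_mulKV.
Qed.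

(** Meant for the left translations [f = circ a], one [a] at a time. *)
Lemma heap_morph_split (f k h : A -> A) :
    (forall b c, f (dia b c) = dia (k b) (h c)) ->
  forall b c d, f (heap dia inv b c d) = heap dia inv (f b) (f c) (f d).
Proof.
move=> fM b c d.
have fb : f b = dia (k (dia b (inv c))) (h c).
  by rewrite -fM -(group_assoc gA) (group_left_inv gA) (group_right_id gA).
have f1 x : f x = dia (k e) (h x) by rewrite -fM (group_left_id gA).
by rewrite fb (f1 c) (f1 d) heap_mul -fM.
Qed.

End Group.

Theorem theorem2p5 (A : Type) (dia : A -> A -> A) (e : A) (inv : A -> A)
    (circ : A -> A -> A)
    (group_dia : is_group dia e inv) (semigroup_circ : is_semigroup circ) :
  [<-> (exists sigma : A -> A, is_skew_truss dia e inv circ sigma);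
       (exists lambda : A -> (A -> A), forall a b c : A,
          circ a (dia b c) = dia (circ a b) (lambda a c));
       (exists mu : A -> (A -> A), forall a b c : A,
          circ a (dia b c) = dia (mu a b) (circ a c));
       (exists kappa kappahat : A -> (A -> A), forall a b c : A,
          circ a (dia b c) = dia (kappa a b) (kappahat a c));
       (forall a b c d : A,
          circ a (heap dia inv b c d) =
          heap dia inv (circ a b) (circ a c) (circ a d))].
Proof.
tfae.
- case=> sigma truss.
  exists (fun a c => dia (inv (sigma a)) (circ a c)) => a b c.
  by rewrite (truss_distr truss) (group_assoc group_dia).
- case=> lambda lamP.
  (* Writing [c] as [dia e c] in [circ a c] gives [circ a c = dia (circ a e) (lambda a c)]; solving
     for [lambda a c] puts the inverse of [circ a e] into [mu]. *)
  exists (fun a b => dia (circ a b) (inv (circ a e))) => a b c.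
  rewrite -{2}(group_left_id group_dia c) !lamP -(group_assoc group_dia).
  by rewrite (group_mulVK group_dia).
- by case=> mu muP; exists mu, circ.
- case=> kappa [kappahat kappaP] a.
  exact: (heap_morph_split group_dia (kappaP a)).
- move=> heapP; exists (circ^~ e); split=> // a b c.
  by rewrite -(heap1 group_dia b c) heapP.
Qed.
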